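(* Fix constants $\alpha>0$ and $\beta\ge1/6$, and run the algorithm SELECT described in the context with $f(n):=n^{2/3}\ln^{1/3}n$, $s(n):=\min\{\lceil\alpha f(n)\rceil,n-1\}$ and $g(n):=(\beta s(n)\ln n)^{1/2}$. There exists a constant $\gamma>0$ such that the following holds. For every $n\ge1$, every $k$ with $1\le k\le n$, and every input list $X$ of size $n$, the expected number $C_{nk}$ of comparisons made by SELECT$(X,k)$ satisfies $$C_{nk}\le n+\min\{k,n-k\}+\gamma f(n).$$
   Context: Algorithm SELECT$(X,k)$. The input is a list $X$ of $n$ elements of a totally ordered set (repeated values allowed) and an integer $1\le k\le n$. It returns the $k$th smallest element, i.e. the $k$th entry of $X$ sorted nondecreasingly. The sample size $s=s(n)$ and gap $g=g(n)>0$ are given functions with $1\le s(n)\le n-1$ for $n\ge2$. 1. If $n=1$, return the single element. Otherwise set $s:=s(n)$ and $g:=g(n)$. 2. Choose a set of $s$ positions of $X$ uniformly at random among all $s$-subsets, independently of all other random choices. Let $S$ be the sub-list at those positions. 3. Set $i_u:=\max\{\lceil ks/n-g\rceil,1\}$ and $i_v:=\min\{\lceil ks/n+g\rceil,s\}$. Find $u$, the $i_u$th smallest element of $S$, by the recursive call SELECT$(S,i_u)$. If $i_v>i_u$, find $v$ as the $(i_v-i_u)$th smallest element of the sub-list of $S$ formed by its $s-i_u$ largest elements, by a recursive call of SELECT; if $i_v=i_u$, set $v:=u$. - It is assumed that each call of SELECT identifies, without extra comparisons, which elements form the $k$ smallest. - It is assumed that after Step 3 the relation ($<$, $=$, $>$)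 of every sample element to $u$ and to $v$ is known without further comparisons. 4. Each element $x$ of $X$ not in the sample is compared with the pivots. - If $k<n/2$: $x$ is compared with $v$ first, and with $u$ only if $x<v$ and $u<v$. - If $k\ge n/2$: $x$ is compared with $u$ first, and with $v$ only if $x>u$ and $u<v$. This yields the partition of $X$ into $L=\{x<u\}$, $U=\{x=u\}$, $M=\{u<x<v\}$, $V=\{x=v\}$ and $R=\{x>v\}$. 5. If $|L|<k\le|L\cup U|$, return $u$. If $|L\cup U\cup M|<k\le n-|R|$, return $v$. 6. If $k\le|L|$, set $\hat X:=L$ and $\hat k:=k$. Else if $n-|R|<k$, set $\hat X:=R$ and $\hat k:=k-n+|R|$. Else set $\hat X:=M$ and $\hat k:=k-|L\cup U|$. 7. Return SELECT$(\hat X,\hat k)$. The comparisons counted are those made in Step 4 together with all comparisons made in the recursive calls of Steps 3 and 7. The expectation is over all random sample choices. *)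

(* Defs.v *)
From HB Require Import structures.
From mathcomp Require Import all_boot all_order all_algebra.
From mathcomp Require Import all_classical all_reals all_analysis.
Set Implicit Arguments. Unset Strict Implicit. Unset Printing Implicit Defensive.
Import Order.TTheory GRing.Theory Num.Theory.
Local Open Scope ring_scope.

Section Select.
Variable R : realType.
Variables (alpha beta : R).

Definition fsel (n : nat) : R := (n%:R `^ (2/3)) * ((ln n%:R) `^ (1/3)).

(* s(n) = min { ceil (alpha f(n)), n - 1 }  (alpha f(n) >= 0, so the ceiling is >= 0) *)
Definition ssel (n : nat) : nat := minn `|Num.ceil (alpha * fsel n)|%N n.-1.

Definition gsel (n : nat) : R := Num.sqrt (beta * (ssel n)%:R * ln n%:R).

Definition iu_sel (n k : nat) : nat :=
  `|Num.max (Num.ceil (k%:R * (ssel n)%:R / n%:R - gsel n)) 1|%N.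

Definition iv_sel (n k : nat) : nat :=
  `|Num.min (Num.ceil (k%:R * (ssel n)%:R / n%:R + gsel n)) (ssel n)%:Z|%N.

Variable (disp : Order.disp_t) (T : orderType disp).

(* Expected number of comparisons of SELECT(X,k).  [fuel] only serves to make the
   recursion structural: every recursive call is on a list strictly shorter than X,
   so with initial fuel = size X the case [fuel = 0] is never reached on a
   nonempty list.  The expectation over the uniformly random s-subset of positions
   chosen at the top level is the average over all such subsets; the recursive
   calls use independent randomness, so (by linearity) their contribution is their
   own expected cost. *)
Fixpoint sel_cost (fuel : nat) (X : seq T) (k : nat) {struct fuel} : R :=
  match fuel, X with
  | 0, _ => 0
  | _, [::] => 0
  | fuel'.+1, x0 :: _ =>
    let n := size X in
    if n == 1%N then 0 else
    let s := ssel n in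
    let iu := iu_sel n k in
    let iv := iv_sel n k in
    (\sum_(S : {set 'I_n} | #|S| == s)
       let smp := [seq nth x0 X (val i) | i <- enum S] in
       let srt := sort <=%O smp in
       let u := nth x0 srt iu.-1 in
       let v := nth x0 srt iv.-1 in
       let c_u := sel_cost fuel' smp iu in
       let c_v := if (iu < iv)%N then sel_cost fuel' (drop iu srt) (iv - iu) else 0 in
       (* Step 4: comparisons of non-sample elements with the pivots *)
       let rest := [seq nth x0 X (val i) | i <- enum (~: S)] in
       let c4 := (\sum_(x <- rest)
                    (if (2 * k < n)%N
                     then 1 + ((x < v)%O && (u < v)%O)
                     else 1 + ((u < x)%O && (u < v)%O)))%N in
       let cL := count (fun x => (x < u)%O) X in
       let cLU := count (fun x => (x <= u)%O) X in
       let cLUM := count (fun x => (x <= u)%O || ((u < x)%O && (x < v)%O)) X in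
       let cR := count (fun x => (v < x)%O) X in
       let c7 :=
         if (cL < k <= cLU)%N then 0
         else if (cLUM < k <= n - cR)%N then 0
         else if (k <= cL)%N then sel_cost fuel' (seq.filter (fun x => (x < u)%O) X) k
         else if (n - cR < k)%N then
           sel_cost fuel' (seq.filter (fun x => (v < x)%O) X) (k - (n - cR))
         else sel_cost fuel' (seq.filter (fun x => (u < x)%O && (x < v)%O) X) (k - cLU) in
       c4%:R + c_u + c_v + c7)
    / #|[set S : {set 'I_n} | #|S| == s]|%:R
  end.

Definition select_cost (X : seq T) (k : nat) : R := sel_cost (size X) X k.

End Select.

(* Main.v *)
Require Import Defs.
From mathcomp Require Import all_boot all_order all_algebra.
From mathcomp Require Import all_classical all_reals all_analysis.
From mathcomp Require Import ring lra zify.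
Import Order.TTheory GRing.Theory Num.Theory.
Local Open Scope ring_scope.
Set Implicit Arguments.
Unset Strict Implicit.
Unset Printing Implicit Defensive.

(** Let q = g n / s.  If A is the set of positions of the j smallest elements of X,
then |S /\ A| is hypergeometric, and Hoeffding's bound makes a deviation of g from its
mean j s / n have probability at most exp (- 2 g^2 / s) = n^(- 2 beta) <= n^(- 1/3).
Applying this with j about k + 2 q, k - 2 q, k and k - 1 shows that, outside an event
of probability 4 n^(- 1/3), at most k + 2 q + 1 elements are below v, at most
n - k + 2 q + 1 are above u, and the list of Step 7 has at most 4 q + 2 elements.
Step 4 then costs n + min (k, n - k) + O(q), the exceptional event contributes
O(n^(2/3)), and q and s are O(f(n)).  Since s and 4 q + 2 are o(n), the recursive
terms gamma f(s) and gamma f(4 q + 2) are small fractions of gamma f(n), and the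
induction closes for large n; the finitely many remaining n are absorbed in gamma. *)

(** * Sampling without replacement *)

Section SampleMean.
Variables (R : numFieldType) (T : finType).
Implicit Types (s : nat) (S : {set T}) (F G : {set T} -> R) (E : pred {set T}).

Definition sample_mean s F : R :=
  (\sum_(S : {set T} | #|S| == s) F S) / #|[set S : {set T} | #|S| == s]|%:R.

Definition sample_prob s E : R := sample_mean s (fun S => (E S)%:R).

Lemma sample_mean_le s F G :
  (forall S, #|S| = s -> F S <= G S) -> sample_mean s F <= sample_mean s G.
Proof.
by move=> leFG; rewrite ler_wpM2r ?invr_ge0 //; apply: ler_sum => S /eqP; exact: leFG.
Qed.

Lemma sample_meanD s F G :
  sample_mean s (fun S => F S + G S) = sample_mean s F + sample_mean s G.
Proof. by rewrite /sample_mean big_split mulrDl. Qed.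

Lemma sample_meanZ s (c : R) F : sample_mean s (fun S => c * F S) = c * sample_mean s F.
Proof. by rewrite /sample_mean -mulr_sumr mulrA. Qed.

Lemma sample_mean_cst s (c : R) : (s <= #|T|)%N -> sample_mean s (fun=> c) = c.
Proof.
move=> le_sT; rewrite /sample_mean sumr_const -[c *+ _]mulr_natr cardsE mulfK //.
by rewrite -cardsE card_draws pnatr_eq0 -lt0n bin_gt0.
Qed.

Lemma sample_prob_sub s E1 E2 :
  (forall S, #|S| = s -> E1 S -> E2 S) -> sample_prob s E1 <= sample_prob s E2.
Proof.
move=> sub; apply: sample_mean_le => S /sub.
by case: (E1 S) => // /(_ isT) ->.
Qed.

Lemma sample_probU_le s E1 E2 (p1 p2 : R) :
  sample_prob s E1 <= p1 -> sample_prob s E2 <= p2 ->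
  sample_prob s (fun S => E1 S || E2 S) <= p1 + p2.
Proof.
move=> le_p1 le_p2; apply: le_trans (lerD le_p1 le_p2).
rewrite -sample_meanD; apply: sample_mean_le => S _.
by rewrite -natrD ler_nat; case: (E1 S); case: (E2 S).
Qed.

Lemma sample_prob_eq0 s E : (forall S, #|S| = s -> ~~ E S) -> sample_prob s E = 0.
Proof.
move=> notE; rewrite /sample_prob /sample_mean big1 ?mul0r // => S /eqP /notE.
by move/negPf->.
Qed.

Lemma sample_mean_le_except s F E (a b : R) : (s <= #|T|)%N ->
  (forall S, #|S| = s -> ~~ E S -> F S <= a) ->
  (forall S, #|S| = s -> F S <= a + b) ->
  sample_mean s F <= a + b * sample_prob s E.
Proof.
move=> le_sT Fa Fab; rewrite -[a in leRHS](sample_mean_cst a le_sT) -sample_meanZ.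
rewrite -sample_meanD; apply: sample_mean_le => S cS.
by case: (boolP (E S)) => [_|nE]; rewrite ?mulr1 ?mulr0 ?addr0; [exact: Fab | exact: Fa].
Qed.

End SampleMean.

Lemma sum_subsets_card (R : nmodType) (T : finType) (B : {set T}) (F : nat -> R) :
  \sum_(J : {set T} | J \subset B) F #|J|
    = \sum_(j < #|T|.+1) F j *+ 'C(#|B|, j).
Proof.
rewrite (partition_big (fun J : {set T} => inord #|J| : 'I_#|T|.+1) xpredT) //=.
apply: eq_bigr => j _; rewrite -cards_draws -sumr_const.
have cardE (J : {set T}) : (inord #|J| == j) = (#|J| == j).
  by rewrite -val_eqE /= inordK // ltnS max_card.
rewrite (eq_bigl (fun J : {set T} => J \in [set A : {set T} | A \subset B & #|A| == j])).
  by apply: eq_bigr => J; rewrite inE => /andP[_ /eqP->].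
by move=> J; rewrite inE cardE.
Qed.

Lemma exprD1n_wide (R : comPzRingType) (y : R) (m N : nat) :
  (m <= N)%N -> (1 + y) ^+ m = \sum_(j < N.+1) y ^+ j *+ 'C(m, j).
Proof.
move=> le_mN; rewrite exprDn.
under eq_bigr => i _ do rewrite expr1n mul1r.
rewrite (big_ord_widen N.+1 (fun i => y ^+ i *+ 'C(m, i))) // [LHS]big_mkcond /=.
apply: eq_bigr => i _; case: ifP => // /negbT.
by rewrite -leqNgt => lt_mi; rewrite bin_small // mulr0n.
Qed.

Lemma card_supersets (T : finType) (J : {set T}) (s : nat) : (s <= #|T|)%N ->
  #|[set S : {set T} | J \subset S & #|S| == s]| = 'C(#|T| - #|J|, #|T| - s).
Proof.
move=> le_sT; have -> : (#|T| - #|J|)%N = #|~: J| by rewrite [RHS]cardsCs finset.setCK.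
rewrite -cards_draws -(card_imset _ (@finset.setC_inj T)).
apply: eq_card => S; rewrite !inE; apply/imsetP/andP => [[U]|[sSJ /eqP cS]].
  rewrite inE => /andP[sJU /eqP cU] ->; rewrite finset.setCS sJU; split=> //.
  by rewrite [#|~: U|]cardsCs finset.setCK cU.
exists (~: S); last by rewrite finset.setCK.
by rewrite inE -finset.setCS finset.setCK sSJ cardsCs finset.setCK cS subKn ?eqxx.
Qed.

Lemma sum_exp_card_setI (R : comPzRingType) (T : finType) (A : {set T}) (s : nat) (y : R) :
  (s <= #|T|)%N ->
  \sum_(S : {set T} | #|S| == s) (1 + y) ^+ #|S :&: A|
    = \sum_(j < #|T|.+1) y ^+ j *+ ('C(#|A|, j) * 'C(#|T| - j, #|T| - s)).
Proof.
move=> le_sT.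
under eq_bigr => S _ do rewrite (exprD1n_wide y (max_card (mem (S :&: A))))
  -(sum_subsets_card (S :&: A) (fun j => y ^+ j)).
rewrite (exchange_big_dep (fun J : {set T} => J \subset A)) /=; last first.
  by move=> S J _; rewrite finset.subsetI => /andP[].
under eq_bigr => J sJA.
  rewrite sumr_const.
  rewrite (eq_card (B := [set S : {set T} | J \subset S & #|S| == s])); last first.
    by move=> S; rewrite !inE unfold_in finset.subsetI sJA andbT andbC.
  rewrite card_supersets //.
  over.
rewrite (sum_subsets_card A (fun j => y ^+ j *+ 'C(#|T| - j, #|T| - s))).
by apply: eq_bigr => j _; rewrite -mulrnA mulnC.
Qed.

Lemma ffact_expn_le (a n j : nat) : (a <= n)%N -> (a ^_ j * n ^ j <= n ^_ j * a ^ j)%N.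
Proof.
move=> le_an; elim: j => // j IHj; rewrite !ffactnSr !expnSr mulnACA [leqRHS]mulnACA.
apply: leq_mul => //; rewrite !mulnBl (mulnC n a) leq_sub2l // leq_mul2l le_an.
by rewrite orbT.
Qed.

Lemma bin_expn_le (a n j : nat) : (a <= n)%N -> ('C(a, j) * n ^ j <= 'C(n, j) * a ^ j)%N.
Proof.
move=> /(ffact_expn_le j); rewrite -!bin_ffact.
by rewrite mulnAC [leqRHS]mulnAC leq_pmul2r // fact_gt0.
Qed.

Lemma mul_bin_sub (n s j : nat) :
  (s <= n)%N -> ('C(n, s) * 'C(s, j) = 'C(n, j) * 'C(n - j, n - s))%N.
Proof.
move=> le_sn; have [le_js|lt_sj] := leqP j s; last first.
  rewrite (bin_small lt_sj) muln0; case: (leqP j n) => [le_jn|lt_jn].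
    by rewrite [X in (_ * X)%N]bin_small ?muln0 // ltn_sub2l // (leq_trans lt_sj).
  by rewrite (bin_small lt_jn).
have le_jn := leq_trans le_js le_sn.
apply/eqP; rewrite -(@eqn_pmul2r (j`! * (s - j)`! * (n - s)`!)) ?muln_gt0 ?fact_gt0 //.
apply/eqP; transitivity n`!.
  by rewrite -(bin_fact le_sn) -(bin_fact le_js); ring.
have /bin_fact : (n - s <= n - j)%N by rewrite leq_sub2l.
have -> : (n - j - (n - s) = s - j)%N by lia.
by move=> facts; rewrite -(bin_fact le_jn) -facts; ring.
Qed.

(* Expanding in powers of [y] turns both sides into factorial moments; those of the
   hypergeometric law are dominated by the binomial ones since
   a (a-1) ... (a-j+1) / (n (n-1) ... (n-j+1)) <= (a / n)^j. *)
Lemma sample_mean_exp_le (R : numFieldType) (T : finType) (A : {set T}) (s : nat) (y : R) :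
  (s <= #|T|)%N -> (0 < #|T|)%N -> 0 <= y ->
  sample_mean s (fun S => (1 + y) ^+ #|S :&: A|)
    <= (1 + y * (#|A|%:R / #|T|%:R)) ^+ s.
Proof.
move=> le_sT T_gt0 y_ge0; have binT_gt0 : 0 < 'C(#|T|, s)%:R :> R by rewrite ltr0n bin_gt0.
rewrite /sample_mean card_draws ler_pdivrMr // mulrC.
rewrite sum_exp_card_setI // (exprD1n_wide _ le_sT) mulr_sumr.
apply: ler_sum => j _; set n := #|T|; set a := #|A|.
have nj_gt0 : 0 < n%:R ^+ j :> R by rewrite exprn_gt0 // ltr0n.
have -> : y ^+ j *+ ('C(a, j) * 'C(n - j, n - s)) =
    y ^+ j * (('C(a, j) * n ^ j * 'C(n - j, n - s))%:R / n%:R ^+ j).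
  by rewrite mulnAC [in RHS]natrM natrX -mulr_natr mulfK // lt0r_neq0.
have -> : 'C(n, s)%:R * ((y * (a%:R / n%:R)) ^+ j *+ 'C(s, j)) =
    y ^+ j * (('C(n, s) * 'C(s, j) * a ^ j)%:R / n%:R ^+ j).
  by rewrite -mulr_natr !exprMn exprVn !natrM natrX; ring.
apply: ler_wpM2l; first exact: exprn_ge0.
rewrite ler_pM2r ?invr_gt0 // ler_nat mul_bin_sub // [leqRHS]mulnAC leq_mul2r.
by rewrite bin_expn_le ?orbT // max_card.
Qed.

(** * Hoeffding's inequality *)

Lemma is_derive_ge0_le (R : realType) (f df : R -> R) (a x : R) :
  (forall y : R, is_derive y 1 f (df y)) -> (forall y, a <= y -> 0 <= df y) ->
  a <= x -> f a <= f x.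
Proof.
move=> fdf df_ge0 ax; apply: (@ger0_derive1_ndecry _ f a) => // [y|].
- rewrite in_itv /= andbT => ay; rewrite derive1E.
  by case: (fdf y) => _ ->; rewrite df_ge0 // ltW.
- by apply: derivable_within_continuous => y _; case: (fdf y).
Qed.

Section BernoulliMgf.
Variables (R : realType) (p : R).
Hypothesis p01 : 0 <= p <= 1.

Definition bernoulli_mgf (x : R) : R := 1 - p + p * expR x.

Lemma bernoulli_mgf_gt0 (x : R) : 0 < bernoulli_mgf x.
Proof.
have /andP[p_ge0 p_le1] := p01; rewrite /bernoulli_mgf.
have [->|p_neq0] := eqVneq p 0; first by rewrite mul0r; lra.
by rewrite ltr_wpDl ?subr_ge0 // mulr_gt0 ?expR_gt0 // lt0r p_neq0.
Qed.

Lemma is_derive_bernoulli_mgf (x : R) : is_derive x 1 bernoulli_mgf (p * expR x).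
Proof. by apply: is_derive_eq; rewrite /GRing.scale /=; ring. Qed.

(* The left-hand side q is the derivative of [ln \o bernoulli_mgf], and
   q' = q (1 - q) <= 1/4. *)
Lemma bernoulli_log_mgf_derive_le (l : R) : 0 <= l ->
  p * expR l / bernoulli_mgf l <= p + l / 4.
Proof.
move=> l_ge0; have mgf_gt0 := bernoulli_mgf_gt0.
pose f x : R := p + x / 4 - p * expR x / bernoulli_mgf x.
pose df x : R := 1 / 4 - p * expR x * (1 - p) / bernoulli_mgf x ^+ 2.
suff : f 0 <= f l by rewrite /f /bernoulli_mgf expR0 !mulr1 subrK divr1 mul0r addr0; lra.
apply: (is_derive_ge0_le (df := df) _ _ l_ge0) => x; last first.
  move=> _; rewrite /df subr_ge0 ler_pdivrMr ?exprn_gt0 // -subr_ge0.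
  rewrite (_ : _ - _ = ((1 - p - p * expR x) / 2) ^+ 2) ?sqr_ge0 //.
  by rewrite /bernoulli_mgf; field.
have mgf_neq0 := lt0r_neq0 (mgf_gt0 x).
have d_inv := @is_deriveV _ _ x _ (1 : R) mgf_neq0 (is_derive_bernoulli_mgf x).
rewrite /f /df; apply: is_derive_eq; rewrite /GRing.scale /=.
by move: mgf_neq0; rewrite /bernoulli_mgf => mgf_neq0; field.
Qed.

Lemma bernoulli_mgf_le (l : R) : 0 <= l -> bernoulli_mgf l <= expR (p * l + l ^+ 2 / 8).
Proof.
move=> l_ge0; pose e x : R := expR (- (p * x + x ^+ 2 / 8)).
pose f x : R := - (bernoulli_mgf x * e x).
pose df x : R := e x * (bernoulli_mgf x * (p + x / 4) - p * expR x).
suff : f 0 <= f l.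
  rewrite /f /e {1}/bernoulli_mgf expR0 mulr1 subrK expr0n mul0r mulr0 addr0 oppr0 expR0.
  by rewrite mulr1 lerN2 expRN ler_pdivrMr ?expR_gt0 // mul1r.
apply: (is_derive_ge0_le (df := df) _ _ l_ge0) => x; last first.
  move=> x_ge0; rewrite mulr_ge0 ?expR_ge0 // subr_ge0.
  have := bernoulli_log_mgf_derive_le x_ge0.
  by rewrite ler_pdivrMr ?bernoulli_mgf_gt0 // [leRHS]mulrC.
have d_mgf := is_derive_bernoulli_mgf x.
have d_exponent : is_derive x 1 (fun y : R => - (p * y + y ^+ 2 / 8)) (- (p + x / 4)).
  by apply: is_derive_eq; rewrite /GRing.scale /=; field.
have d_e : is_derive x 1 e (e x * - (p + x / 4)).
  exact: (is_derive1_comp (is_derive_expR _) d_exponent).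
by rewrite /f /df; apply: is_derive_eq; rewrite /GRing.scale /=; ring.
Qed.

End BernoulliMgf.

Section Hoeffding.
Variables (R : realType) (T : finType) (s : nat) (t : R).
Hypotheses (s_bounds : (0 < s <= #|T|)%N) (t_ge0 : 0 <= t).
Implicit Type A : {set T}.

Definition hoeffding_tail : R := expR (- 2 * t ^+ 2 / s%:R).

Let le_sT : (s <= #|T|)%N. Proof. by case/andP: s_bounds. Qed.

Let T_gt0 : (0 < #|T|)%N. Proof. by case/andP: s_bounds => /leq_trans; apply. Qed.

Lemma hoeffding_sample_ge A :
  sample_prob R s (fun S => s%:R * (#|A|%:R / #|T|%:R) + t <= #|S :&: A|%:R)
    <= hoeffding_tail.
Proof.
set p : R := _ / _.
have s_neq0 : s%:R != 0 :> R by rewrite pnatr_eq0 -lt0n; case/andP: s_bounds.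
have p01 : 0 <= p <= 1.
  by rewrite divr_ge0 //= ler_pdivrMr ?ltr0n // mul1r ler_nat max_card.
(* [l] minimises the Chernoff exponent s l^2 / 8 - l t *)
pose l := 4 * t / s%:R; pose c := expR (- (l * (s%:R * p + t))).
have l_ge0 : 0 <= l by rewrite divr_ge0 ?mulr_ge0.
apply: (@le_trans _ _ (c * sample_mean s (fun S => expR l ^+ #|S :&: A|))).
  rewrite -sample_meanZ; apply: sample_mean_le => S _ /=.
  case: (lerP (_ + t)) => [dev|_]; last first.
    by rewrite mulr_ge0 ?exprn_ge0 ?expR_ge0.
  by rewrite -expRM_natl -expRD -[leLHS]expR0 ler_expR addrC subr_ge0 mulrC ler_wpM2r.
have expl_ge1 : 0 <= expR l - 1 by rewrite subr_ge0 -expR0 ler_expR.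
have mgf_le : sample_mean s (fun S => expR l ^+ #|S :&: A|) <= bernoulli_mgf p l ^+ s.
  have := sample_mean_exp_le A le_sT T_gt0 expl_ge1.
  by rewrite -/p (_ : 1 + (expR l - 1) = expR l) 1?(_ : 1 + _ * p = bernoulli_mgf p l) //;
    rewrite /bernoulli_mgf; ring.
apply: (@le_trans _ _ (c * expR (p * l + l ^+ 2 / 8) ^+ s)).
  rewrite ler_wpM2l ?expR_ge0 // (le_trans mgf_le) // lerXn2r ?bernoulli_mgf_le //.
    by rewrite nnegrE ltW // bernoulli_mgf_gt0.
  by rewrite nnegrE expR_ge0.
rewrite -expRM_natl -expRD ler_expR /l le_eqVlt; apply/orP; left; apply/eqP.
by field.
Qed.

Lemma hoeffding_sample_le A :
  sample_prob R s (fun S => #|S :&: A|%:R <= s%:R * (#|A|%:R / #|T|%:R) - t)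
    <= hoeffding_tail.
Proof.
apply: le_trans (hoeffding_sample_ge (~: A)); apply: sample_prob_sub => S cS /= dev.
have T_neq0 : #|T|%:R != 0 :> R by rewrite pnatr_eq0 -lt0n.
have -> : #|~: A|%:R = #|T|%:R - #|A|%:R :> R by rewrite -(cardsC A) natrD addrC addKr.
have -> : #|S :&: ~: A|%:R = s%:R - #|S :&: A|%:R :> R.
  by rewrite -cS -(cardsID A S) natrD addrC addKr finset.setDE.
by rewrite mulrBl divff //; lra.
Qed.

End Hoeffding.

(** * Ranks of sample elements *)

Section SampleRanks.
Variables (disp : Order.disp_t) (T : orderType disp) (x0 : T).
Implicit Types (X : seq T) (i j : nat).

Lemma count_lt_nth_sort X i :
  (count (< nth x0 (sort <=%O X) i)%O X <= i)%N.
Proof.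
rewrite leqNgt; apply/negP => i_lt.
have /nth_count_lt : sorted <=%O (sort <=%O X) by exact: sort_le_sorted.
move=> /(_ (nth x0 (sort <=%O X) i) x0 i).
by rewrite ltxx (permP (permEl (perm_sort _ _))) => /(_ i_lt).
Qed.

Lemma count_le_nth_sort X i : (i < size X)%N ->
  (i < count (<= nth x0 (sort <=%O X) i)%O X)%N.
Proof.
move=> iX; rewrite ltnNge; apply/negP => le_i.
have /nth_count_gt : sorted <=%O (sort <=%O X) by exact: sort_le_sorted.
move=> /(_ (nth x0 (sort <=%O X) i) x0 i).
by rewrite ltxx (permP (permEl (perm_sort _ _))) size_sort le_i iX => /(_ isT).
Qed.

Lemma count_lt_size X (P : pred T) y : y \in X -> ~~ P y -> (count P X < size X)%N.
Proof.
move=> yX nPy; rewrite ltn_neqAle count_size andbT -all_count.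
by apply: contra nPy => /allP; apply.
Qed.

Lemma count_gt X v : count (> v)%O X = (size X - count (<= v)%O X)%N.
Proof.
rewrite -(count_predC (<= v)%O X) addKn.
by apply: eq_count => x /=; rewrite ltNge.
Qed.

Lemma count_between X u v : count (fun x => (u < x)%O && (x < v)%O) X =
  (count (< v)%O X - count (<= u)%O X)%N.
Proof.
have [lt_uv|le_vu] := ltP u v; last first.
  have /eqP-> : (count (< v)%O X - count (<= u)%O X == 0)%N.
    by rewrite subn_eq0 sub_count // => x /= xv; rewrite (le_trans (ltW xv)).
  rewrite -(count_pred0 X); apply: eq_count => x /=.
  by apply/negP => /andP[/lt_trans ux /ux]; rewrite ltNge le_vu.
suff <- : (count (fun x => u < x < v)%O X + count (<= u)%O X
    = count (< v)%O X)%N by rewrite addnK.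
rewrite -count_predUI [X in (_ + X)%N](eq_count (a2 := pred0)) ?count_pred0 ?addn0.
  apply: eq_count => x /=; case: (leP x u) => [le_xu|] /=; last by rewrite orbF.
  by rewrite (le_lt_trans le_xu).
by move=> x /=; rewrite ltNge andbAC andNb.
Qed.

Lemma count_positions X (P : pred T) :
  count P X = #|[set i : 'I_(size X) | P (nth x0 X i)]|.
Proof.
rewrite -{1}(mkseq_nth x0 X) /mkseq count_map -val_enum_ord count_map.
by rewrite cardsE cardE -size_filter enumT.
Qed.

Variable X : seq T.
Implicit Types A S : {set 'I_(size X)}.

Definition sample_seq S : seq T := [seq nth x0 X (val a) | a <- enum S].

Definition sample_sort S : seq T := sort <=%O (sample_seq S).

Lemma size_sample_seq S : size (sample_seq S) = #|S|.
Proof. by rewrite size_map -cardE. Qed.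

Lemma size_sample_sort S : size (sample_sort S) = #|S|.
Proof. by rewrite size_sort size_sample_seq. Qed.

Lemma nth_sample_sort_in S i : x0 \in X -> nth x0 (sample_sort S) i \in X.
Proof.
move=> x0X; have [lt_i|le_i] := ltnP i (size (sample_sort S)); last by rewrite nth_default.
by have := mem_nth x0 lt_i; rewrite mem_sort => /mapP[a _ ->]; exact: mem_nth (ltn_ord a).
Qed.

Lemma count_sample_seq S (P : pred T) :
  count P (sample_seq S) = #|S :&: [set a : 'I_(size X) | P (nth x0 X a)]|.
Proof.
rewrite count_map -size_filter cardE; congr size.
rewrite /enum_mem -filter_predI; apply: eq_filter => a.
by rewrite /= !inE andbC.
Qed.

Definition initial_positions A : Prop :=
  forall a b : 'I_(size X), a \in A -> b \notin A -> (nth x0 X a <= nth x0 X b)%O.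

Lemma initial_positions_ex j : (j <= size X)%N ->
  exists2 A : {set 'I_(size X)}, #|A| = j & initial_positions A.
Proof.
move=> le_jn; pose r (a b : 'I_(size X)) := (nth x0 X a <= nth x0 X b)%O.
have r_trans : transitive r by move=> b a c; exact: le_trans.
have r_total : total r by move=> a b; exact: le_total.
pose w := sort r (enum 'I_(size X)).
have uniq_w : uniq w by rewrite sort_uniq enum_uniq.
have size_w : size w = size X by rewrite size_sort size_enum_ord.
exists [set a in take j w].
  by rewrite cardsE (card_uniqP (take_uniq j uniq_w)) size_takel // size_w.
move=> a b; rewrite !inE => aw bw.
have : pairwise r w by rewrite -sorted_pairwise // sort_sorted.
rewrite -(cat_take_drop j w) pairwise_cat => /and3P[/allrelP r_take_drop _ _].
apply: r_take_drop => //.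
have : b \in w by rewrite mem_sort mem_enum.
by rewrite -{1}(cat_take_drop j w) mem_cat (negPf bw).
Qed.

Lemma count_lt_sample_nth A S i : initial_positions A -> (i < #|S :&: A|)%N ->
  (count (< nth x0 (sample_sort S) i)%O X < #|A|)%N.
Proof.
move=> iniA iSA; set y := nth _ _ _.
pose L := [set a : 'I_(size X) | (nth x0 X a < y)%O].
have SL : (#|S :&: L| < #|S :&: A|)%N.
  rewrite -(count_sample_seq S (< y)%O).
  exact: leq_ltn_trans (count_lt_nth_sort _ _) iSA.
have [a aSA aL] : exists2 a, a \in S :&: A & a \notin L.
  apply/subsetPn; apply: contraL SL => sSAL; rewrite -leqNgt subset_leq_card //.
  by rewrite finset.subsetI finset.subsetIl.
have aA : a \in A by move: aSA; rewrite inE => /andP[].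
rewrite count_positions -/L; apply: proper_card; apply/properP; split; last by exists a.
apply/fintype.subsetP => b bL; apply: contraNT aL => bA.
by rewrite inE (le_lt_trans (iniA _ _ aA bA)) //; rewrite inE in bL.
Qed.

Lemma count_le_sample_nth A S i : initial_positions A -> (#|S :&: A| <= i < #|S|)%N ->
  (#|A| < count (<= nth x0 (sample_sort S) i)%O X)%N.
Proof.
move=> iniA /andP[SAi iS]; set y := nth _ _ _.
pose L := [set a : 'I_(size X) | (nth x0 X a <= y)%O].
have SL : (#|S :&: A| < #|S :&: L|)%N.
  rewrite -(count_sample_seq S (<= y)%O).
  by apply: leq_ltn_trans SAi _; apply: count_le_nth_sort; rewrite size_sample_seq.
have [b bSL bA] : exists2 b, b \in S :&: L & b \notin A.
  apply/subsetPn; apply: contraL SL => sSLA; rewrite -leqNgt subset_leq_card //.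
  by rewrite finset.subsetI finset.subsetIl.
have bL : b \in L by move: bSL; rewrite inE => /andP[].
rewrite count_positions -/L; apply: proper_card; apply/properP; split; last by exists b.
apply/fintype.subsetP => a aA.
by rewrite inE (le_trans (iniA _ _ aA bA)) //; rewrite inE in bL.
Qed.

Section Tails.
Variables (R : realType) (s : nat) (t : R).
Hypotheses (s_bounds : (0 < s <= size X)%N) (t_ge0 : 0 <= t).

Let s_bounds_card : (0 < s <= #|'I_(size X)|)%N. Proof. by rewrite card_ord. Qed.

Lemma prob_sample_nth_high_le i j : i%:R <= s%:R * (j%:R / (size X)%:R) - t ->
  sample_prob R s
    (fun S : {set 'I_(size X)} => j <= count (< nth x0 (sample_sort S) i)%O X)%N
    <= hoeffding_tail s t.
Proof.
move=> le_i; have [lt_nj|le_jn] := ltnP (size X) j.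
  rewrite sample_prob_eq0 ?expR_ge0 // => S _.
  by rewrite -ltnNge; apply: leq_ltn_trans lt_nj; exact: count_size.
have [A cA iniA] := initial_positions_ex le_jn.
apply: le_trans (hoeffding_sample_le s_bounds_card t_ge0 A).
apply: sample_prob_sub => S _; rewrite -cA card_ord => le_A.
apply: le_trans (_ : i%:R <= _); last by rewrite cA.
rewrite ler_nat leqNgt; apply: contraL le_A => iSA.
by rewrite -ltnNge; exact: count_lt_sample_nth.
Qed.

Lemma prob_sample_nth_low_le i j : (i < s)%N -> (j <= size X)%N ->
  s%:R * (j%:R / (size X)%:R) + t <= i.+1%:R ->
  sample_prob R s
    (fun S : {set 'I_(size X)} => count (<= nth x0 (sample_sort S) i)%O X <= j)%N
    <= hoeffding_tail s t.
Proof.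
move=> lt_is le_jn ge_i; have [A cA iniA] := initial_positions_ex le_jn.
apply: le_trans (hoeffding_sample_ge s_bounds_card t_ge0 A).
apply: sample_prob_sub => S cS; rewrite -cA card_ord => le_A.
apply: (@le_trans _ _ i.+1%:R); first by rewrite cA.
rewrite ler_nat ltnNge; apply: contraL le_A => SAi.
by rewrite -ltnNge; apply: count_le_sample_nth; rewrite // SAi cS.
Qed.

End Tails.

End SampleRanks.

(** * Pivots *)

Section PivotRanks.
Variables (R : realType) (s : nat) (g : R) (n k : nat).

(* [iu_sel] and [iv_sel] for an arbitrary sample size [s] and gap [g]. *)
Definition lower_rank : nat := `|Num.max (Num.ceil (k%:R * s%:R / n%:R - g)) 1|%N.

Definition upper_rank : nat := `|Num.min (Num.ceil (k%:R * s%:R / n%:R + g)) s%:Z|%N.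

(* [g] ranks in the sample correspond to [g n / s] ranks in the input. *)
Definition rank_gap : R := g * n%:R / s%:R.

Hypotheses (k_bounds : (1 <= k <= n)%N) (s_gt0 : (0 < s)%N) (g_ge0 : 0 <= g).
Let target : R := k%:R * s%:R / n%:R.

Let n_gt0 : 0 < n%:R :> R.
Proof. by rewrite ltr0n; case/andP: k_bounds => /leq_trans k1 /k1. Qed.

Let target_gt0 : 0 < target.
Proof. by rewrite divr_gt0 // mulr_gt0 ?ltr0n //; case/andP: k_bounds. Qed.

Let target_le : target <= s%:R.
Proof. by rewrite ler_pdivrMr // mulrC ler_wpM2l // ler_nat; case/andP: k_bounds. Qed.

Lemma rank_gap_ge0 : 0 <= rank_gap.
Proof. by rewrite divr_ge0 ?mulr_ge0. Qed.

Lemma scaled_rank_gap (z : R) : s%:R * ((k%:R + z * rank_gap) / n%:R) = target + z * g.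
Proof. by rewrite /rank_gap /target; field; rewrite (lt0r_neq0 n_gt0) pnatr_eq0 -lt0n. Qed.

Lemma lower_rankE : lower_rank%:Z = Num.max (Num.ceil (target - g)) 1.
Proof. by rewrite /lower_rank gez0_abs // le_max ler01 orbT. Qed.

Lemma upper_rankE : upper_rank%:Z = Num.min (Num.ceil (target + g)) s%:Z.
Proof.
rewrite /upper_rank gez0_abs // le_min lez_nat leq0n andbT ceil_ge0 -/target.
by have := target_gt0; have := g_ge0; lra.
Qed.

Lemma lower_rank_gt0 : (0 < lower_rank)%N.
Proof. by rewrite -ltz_nat lower_rankE lt_max ltr01 orbT. Qed.

Lemma lower_rank_le_upper : (lower_rank <= upper_rank)%N.
Proof.
rewrite -lez_nat lower_rankE upper_rankE ge_max !le_min.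
rewrite le_ceil /=; last by have := g_ge0; lra.
rewrite ceil_le_int -(gtz0_ge1 (Num.ceil (target + g))) ceil_gt0.
rewrite ltr_wpDr //= (lez_nat 1) s_gt0 andbT.
by have := target_le; have := g_ge0; rewrite -pmulrn; lra.
Qed.

Lemma upper_rank_gt0 : (0 < upper_rank)%N.
Proof. exact: leq_trans lower_rank_gt0 lower_rank_le_upper. Qed.

Lemma upper_rank_le : (upper_rank <= s)%N.
Proof. by rewrite -lez_nat upper_rankE ge_min lexx orbT. Qed.

Lemma lower_rank_le : (lower_rank <= s)%N.
Proof. exact: leq_trans lower_rank_le_upper upper_rank_le. Qed.

Lemma lower_rank_ge : target - g <= lower_rank%:R.
Proof.
rewrite pmulrn lower_rankE -ceil_le_int.
by rewrite le_max lexx.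
Qed.

Lemma lower_rank_pred_lt : 0 < target - g -> lower_rank.-1%:R < target - g.
Proof.
move=> tg_gt0; rewrite -subn1 natrB ?lower_rank_gt0 //.
rewrite [lower_rank%:R]pmulrn lower_rankE.
rewrite max_l; last by rewrite -gtz0_ge1 ceil_gt0.
by have := ceilB1_lt (target - g); rewrite intrB.
Qed.

Lemma upper_rank_pred_lt : upper_rank.-1%:R < target + g.
Proof.
rewrite -subn1 natrB ?upper_rank_gt0 //.
apply: le_lt_trans (ceilB1_lt (target + g)); rewrite intrB lerD2r.
rewrite pmulrn ler_int upper_rankE.
by rewrite ge_min lexx.
Qed.

Lemma upper_rank_ge : target + g <= s%:R -> target + g <= upper_rank%:R.
Proof.
move=> tg_le; rewrite pmulrn upper_rankE -ceil_le_int.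
by rewrite le_min lexx ceil_le_int.
Qed.

End PivotRanks.

Section Pivots.
Variables (R : realType) (s : nat) (g : R).
Variables (disp : Order.disp_t) (T : orderType disp) (x0 : T) (X : seq T) (k : nat).
Implicit Type S : {set 'I_(size X)}.
Let n := size X.
Let q := rank_gap s g n.

Definition pivot_u S : T := nth x0 (sample_sort x0 S) (lower_rank s g n k).-1.

Definition pivot_v S : T := nth x0 (sample_sort x0 S) (upper_rank s g n k).-1.

Definition good_pivots S : bool :=
  [&& (count (< pivot_v S)%O X)%:R <= k%:R + 2 * q + 1,
      k%:R - 2 * q - 1 <= (count (<= pivot_u S)%O X)%:R,
      (q < k%:R) ==> (count (< pivot_u S)%O X < k)%N &
      (k%:R + q <= n%:R) ==> (k <= count (<= pivot_v S)%O X)%N].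

Hypotheses (s_bounds : (0 < s <= n)%N) (g_ge0 : 0 <= g) (k_bounds : (1 <= k <= n)%N).

Let s_gt0 : (0 < s)%N. Proof. by case/andP: s_bounds. Qed.

Let n_gt0 : 0 < n%:R :> R.
Proof. by rewrite ltr0n; case/andP: k_bounds => /leq_trans k1 /k1. Qed.

Lemma pivot_u_le_v S : #|S| = s -> (pivot_u S <= pivot_v S)%O.
Proof.
move=> cS; have := upper_rank_le k_bounds s_gt0 g_ge0.
have := lower_rank_le_upper k_bounds s_gt0 g_ge0; have := lower_rank_gt0 s g n k.
move=> lower_gt0 lower_upper upper_le.
apply: (sorted_leq_nth le_trans le_refl); first exact: sort_le_sorted.
all: by rewrite ?inE ?size_sample_sort ?cS; lia.
Qed.

Let q_ge0 : 0 <= q. Proof. exact: rank_gap_ge0. Qed.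

Let target_shift (z : R) : s%:R * ((k%:R + z * q) / n%:R) = k%:R * s%:R / n%:R + z * g.
Proof. exact: scaled_rank_gap. Qed.

Let scale_le (y z : R) : y <= z -> s%:R * (y / n%:R) <= s%:R * (z / n%:R).
Proof. by move=> yz; rewrite ler_wpM2l // ler_wpM2r // invr_ge0 ltW. Qed.

Lemma prob_pivot_v_high_le :
  sample_prob R s (fun S => k%:R + 2 * q + 1 < (count (< pivot_v S)%O X)%:R)
    <= hoeffding_tail s g.
Proof.
pose j := `|Num.ceil (k%:R + 2 * q)|%N.
have jE : j%:R = (Num.ceil (k%:R + 2 * q))%:~R :> R.
  by rewrite natr_absz ger0_norm // ceil_ge0; have := ler0n R k; have := q_ge0; lra.
have j_ge : k%:R + 2 * q <= j%:R by rewrite jE ceil_ge.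
have j_lt : j%:R < k%:R + 2 * q + 1.
  by rewrite jE; have := ceilB1_lt (k%:R + 2 * q); rewrite intrB; lra.
pose i := (upper_rank s g n k).-1.
apply: le_trans (prob_sample_nth_high_le x0 (i := i) (j := j) s_bounds g_ge0 _).
  by apply: sample_prob_sub => S _ high; rewrite -(ler_nat R) ltW // (lt_trans j_lt).
have := upper_rank_pred_lt k_bounds s_gt0 g_ge0.
by have := scale_le j_ge; rewrite target_shift; lra.
Qed.

Lemma prob_pivot_u_low_le :
  sample_prob R s (fun S => (count (<= pivot_u S)%O X)%:R < k%:R - 2 * q - 1)
    <= hoeffding_tail s g.
Proof.
have [neg|nonneg] := ltrP (k%:R - 2 * q) 0.
  rewrite sample_prob_eq0 ?expR_ge0 // => S _; rewrite -leNgt.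
  by apply: le_trans (ler0n _ _); lra.
pose j := Num.truncn (k%:R - 2 * q).
have /andP[j_le j_gt] := truncn_itv nonneg; rewrite -/j -natr1 in j_le j_gt.
have le_jn : (j <= n)%N.
  rewrite -(ler_nat R) (le_trans j_le) // (@le_trans _ _ k%:R) //; last first.
    by rewrite ler_nat; case/andP: k_bounds.
  by have := q_ge0; lra.
pose i := (lower_rank s g n k).-1.
apply: le_trans (prob_sample_nth_low_le x0 (i := i) s_bounds g_ge0 _ le_jn _); rewrite /i.
- by apply: sample_prob_sub => S _ low; rewrite -ltnS -(ltr_nat R) -natr1; move: low; lra.
- by rewrite prednK ?lower_rank_gt0 // lower_rank_le.
rewrite prednK ?lower_rank_gt0 //; have := lower_rank_ge s g n k.
by have := scale_le j_le; rewrite -mulNr target_shift; lra.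
Qed.

Lemma prob_pivot_u_above_target_le :
  sample_prob R s (fun S => (q < k%:R) && (k <= count (< pivot_u S)%O X)%N)
    <= hoeffding_tail s g.
Proof.
have [lt_qk|_] /= := boolP (q < k%:R); last by rewrite sample_prob_eq0 ?expR_ge0.
apply: prob_sample_nth_high_le => //.
have targetE := target_shift 0; rewrite !mul0r !addr0 in targetE.
have gE : s%:R * (q / n%:R) = g by have := target_shift 1; rewrite !mul1r mulrDl; lra.
rewrite targetE; apply/ltW/lower_rank_pred_lt => //.
by rewrite -targetE -gE -mulrBr -mulrBl mulr_gt0 ?ltr0n // divr_gt0 // subr_gt0.
Qed.

Lemma prob_pivot_v_below_target_le :
  sample_prob R s
    (fun S => (k%:R + q <= n%:R) && (count (<= pivot_v S)%O X < k)%N)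
    <= hoeffding_tail s g.
Proof.
have [le_kqn|_] /= := boolP (k%:R + q <= n%:R); last by rewrite sample_prob_eq0 ?expR_ge0.
have /andP[k_gt0 le_kn] := k_bounds.
have lt_upper := upper_rank_gt0 k_bounds s_gt0 g_ge0.
have le_pred : (k.-1 <= n)%N by rewrite (leq_trans (leq_pred k)).
pose i := (upper_rank s g n k).-1.
apply: le_trans (prob_sample_nth_low_le x0 (i := i) s_bounds g_ge0 _ le_pred _); rewrite /i.
- by apply: sample_prob_sub => S _ below; rewrite -ltnS prednK.
- by rewrite prednK // upper_rank_le.
have targetE := target_shift 1; rewrite !mul1r in targetE.
rewrite prednK //; apply: le_trans (upper_rank_ge k_bounds s_gt0 g_ge0 _); last first.
  by rewrite -targetE mulrA ler_pdivrMr // ler_wpM2l.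
have := target_shift 0; rewrite !mul0r !addr0 => <-; rewrite lerD2r; apply: scale_le.
by rewrite ler_nat leq_pred.
Qed.

Lemma prob_not_good_pivots_le :
  sample_prob R s (fun S => ~~ good_pivots S) <= 4 * hoeffding_tail s g.
Proof.
have -> : 4 * hoeffding_tail s g = hoeffding_tail s g + (hoeffding_tail s g
    + (hoeffding_tail s g + hoeffding_tail s g)) by ring.
apply: le_trans (sample_probU_le prob_pivot_v_high_le
  (sample_probU_le prob_pivot_u_low_le
  (sample_probU_le prob_pivot_u_above_target_le prob_pivot_v_below_target_le))).
apply: sample_prob_sub => S _.
by rewrite /good_pivots !negb_and !negb_imply -!ltNge -!leqNgt -ltnNge.
Qed.

End Pivots.

(** * One round of SELECT *)

Section BoundedCost.
Variables (R : realType) (disp : Order.disp_t) (T : orderType disp).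

Definition bounded_cost (cost : seq T -> nat -> R) (B : nat -> nat -> R) : Prop :=
  forall (Y : seq T) (j : nat), (1 <= j <= size Y)%N -> cost Y j <= B (size Y) j.

End BoundedCost.

Section Round.
Variables (R : realType) (s : nat) (g : R).
Variables (disp : Order.disp_t) (T : orderType disp) (x0 : T) (X : seq T) (k : nat).
Implicit Types (S : {set 'I_(size X)}) (u v : T) (m : nat).
Let n := size X.
Let q := rank_gap s g n.

Definition step4_count u v S : nat :=
  (\sum_(x <- sample_seq x0 (~: S))
     (if (2 * k < n)%N then 1 + ((x < v)%O && (u < v)%O)
      else 1 + ((u < x)%O && (u < v)%O)))%N.

Definition step7_cost (cost : seq T -> nat -> R) u v : R :=
  let cL := count (< u)%O X in
  let cLU := count (<= u)%O X in
  let cLUM := count (fun x => (x <= u)%O || ((u < x)%O && (x < v)%O)) X in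
  let cR := count (> v)%O X in
  if (cL < k <= cLU)%N then 0
  else if (cLUM < k <= n - cR)%N then 0
  else if (k <= cL)%N then cost (seq.filter (< u)%O X) k
  else if (n - cR < k)%N then
    cost (seq.filter (> v)%O X) (k - (n - cR))%N
  else cost (seq.filter (fun x => (u < x)%O && (x < v)%O) X) (k - cLU)%N.

Definition round_cost (cost : seq T -> nat -> R) S : R :=
  let iu := lower_rank s g n k in
  let iv := upper_rank s g n k in
  let u := pivot_u s g x0 k S in
  let v := pivot_v s g x0 k S in
  (step4_count u v S)%:R + cost (sample_seq x0 S) iu
  + (if (iu < iv)%N then cost (drop iu (sample_sort x0 S)) (iv - iu)%N else 0)
  + step7_cost cost u v.

Definition mean_round_cost (cost : seq T -> nat -> R) : R := sample_mean s (round_cost cost).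

Lemma step4_count_le u v S : (step4_count u v S <=
  n + (if (2 * k < n)%N then count (< v)%O X else count (> u)%O X))%N.
Proof.
have andb_le (a b : bool) : (a && b <= if a then 1 else 0)%N by case: a; case: b.
have size_rest : (size (sample_seq x0 (~: S)) <= n)%N.
  by rewrite size_sample_seq (leq_trans (max_card _)) // card_ord.
have count_rest (P : pred T) : (count P (sample_seq x0 (~: S)) <= count P X)%N.
  by rewrite count_sample_seq (count_positions x0) subset_leq_card // finset.subsetIr.
rewrite /step4_count; case: ifP => _.
all: rewrite big_split /= sum1_size leq_add //.
all: apply: leq_trans (count_rest _); rewrite -sum1_count [leqRHS]big_mkcond /=.
all: by apply: leq_sum => x _; exact: andb_le.
Qed.

Lemma step4_count_le_double u v S : (step4_count u v S <= 2 * n)%N.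
Proof.
apply: leq_trans (step4_count_le _ _ _) _; rewrite [leqRHS]mul2n -addnn leq_add2l.
by case: ifP => _; exact: count_size.
Qed.

Variables (cost : seq T -> nat -> R) (B : nat -> R).
Hypotheses (B_ge0 : forall m, 0 <= B m) (B_homo : {homo B : m p / (m <= p)%N >-> m <= p}).
Hypotheses (costB : bounded_cost cost (fun m _ => B m)) (k_bounds : (1 <= k <= n)%N).

Let costB_le m (Y : seq T) j : (1 <= j <= size Y)%N -> (size Y <= m)%N -> cost Y j <= B m.
Proof. by move=> /costB/le_trans le_B le_Ym; apply/le_B/B_homo. Qed.

Lemma step7_cost_le u v m :
  ((k <= count (< u)%O X) -> (count (< u)%O X <= m))%N ->
  ((count (<= v)%O X < k) -> (count (> v)%O X <= m))%N ->
  (count (fun x => (u < x)%O && (x < v)%O) X <= m)%N ->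
  step7_cost cost u v <= B m.
Proof.
move=> sizeL sizeR sizeM; have /andP[k_gt0 le_kn] := k_bounds; rewrite /step7_cost -/n.
have cR : (n - count (> v)%O X)%N = count (<= v)%O X.
  by rewrite count_gt subKn // count_size.
have cLUM : count (fun x => (x <= u)%O || ((u < x)%O && (x < v)%O)) X =
    (count (<= u)%O X + count (fun x => (u < x)%O && (x < v)%O) X)%N.
  rewrite -count_predUI -[LHS]addn0; congr addn.
  by rewrite -(count_pred0 X); apply: eq_count => x /=; case: leP.
rewrite {}cR {}cLUM; case: ifP => // not_u; case: ifP => // not_v.
case: ifP => [in_L|not_L]; first by apply: costB_le; rewrite size_filter ?k_gt0 ?sizeL.
case: ifP => [in_R|not_R]; apply: costB_le; rewrite size_filter //.
- by rewrite count_gt -/n; lia.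
- by rewrite sizeR.
- by move: not_u not_v not_L not_R; do 4!move: (count _ X) => ?; lia.
Qed.

Hypotheses (s_bounds : (0 < s <= n)%N) (g_ge0 : 0 <= g).

Lemma round_cost_le S m : #|S| = s ->
  step7_cost cost (pivot_u s g x0 k S) (pivot_v s g x0 k S) <= B m ->
  round_cost cost S <=
    (step4_count (pivot_u s g x0 k S) (pivot_v s g x0 k S) S)%:R + 2 * B s + B m.
Proof.
move=> cS le_m; have /andP[s_gt0 _] := s_bounds.
rewrite /round_cost lerD // -addrA lerD2l mulr_natl mulr2n; apply: lerD.
  by apply: costB_le; rewrite size_sample_seq cS // lower_rank_gt0 lower_rank_le.
case: ifP => // lt_uv; apply: costB_le; rewrite size_drop size_sample_sort cS ?leq_subr //.
by rewrite subn_gt0 lt_uv leq_sub2r // upper_rank_le.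
Qed.

Lemma round_cost_le_double S : x0 \in X -> #|S| = s ->
  round_cost cost S <= 2 * n%:R + 2 * B s + B n.-1.
Proof.
move=> x0X cS; have n_gt0 : (0 < n)%N by case/andP: s_bounds => /leq_trans s1 /s1.
have lt_n m : (m < n -> m <= n.-1)%N by move=> lt_mn; rewrite -ltnS prednK.
set u := pivot_u s g x0 k S; set v := pivot_v s g x0 k S.
have uX : u \in X by exact: nth_sample_sort_in.
have vX : v \in X by exact: nth_sample_sort_in.
have step7_le : step7_cost cost u v <= B n.-1.
  apply: step7_cost_le => [_|_|]; apply: lt_n.
  - by apply: count_lt_size uX _; rewrite /= ltxx.
  - by apply: count_lt_size vX _; rewrite /= ltxx.
  - by apply: count_lt_size uX _; rewrite /= ltxx.
apply: le_trans (round_cost_le cS step7_le) _; rewrite !lerD2r -natrM ler_nat.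
exact: step4_count_le_double.
Qed.

Section GoodPivots.
Variable S : {set 'I_(size X)}.
Hypotheses (cS : #|S| = s) (goodS : good_pivots s g x0 k S).
Let u := pivot_u s g x0 k S.
Let v := pivot_v s g x0 k S.

Lemma step4_count_le_good :
  (step4_count u v S)%:R <= n%:R + (minn k (n - k))%:R + 2 * q + 1.
Proof.
have /and4P[v_high u_low _ _] := goodS; have /andP[_ le_kn] := k_bounds.
have := step4_count_le u v S; rewrite -(ler_nat R) natrD; case: ifP => k2n.
  have /minn_idPl-> : (k <= n - k)%N by rewrite leq_subRL // addnn -mul2n ltnW.
  by move: v_high; rewrite -/v -/q; lra.
have /minn_idPr-> : (n - k <= k)%N by rewrite leq_subLR addnn -mul2n leqNgt k2n.
rewrite count_gt !natrB ?count_size // -/n.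
by move: u_low; rewrite -/u -/q; lra.
Qed.

Lemma step7_cost_le_good : step7_cost cost u v <= B (Num.truncn (4 * q + 2)).
Proof.
have /and4P[v_high u_low u_target v_target] := goodS; have /andP[_ le_kn] := k_bounds.
have q_ge0 : 0 <= q by exact: rank_gap_ge0.
have uv : (u <= v)%O by exact: pivot_u_le_v.
have count_le P : (count P X)%:R <= 4 * q + 2 -> (count P X <= Num.truncn (4 * q + 2))%N.
  by rewrite truncn_ge_nat //; lra.
rewrite -/q -/u -/v -/n in v_high u_low u_target v_target.
apply: step7_cost_le => [in_L|in_R|]; apply: count_le.
- have le_kq : k%:R <= q.
    by rewrite leNgt; apply/negP => /(implyP u_target); rewrite ltnNge in_L.
  apply: (@le_trans _ _ (count (< v)%O X)%:R); last by lra.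
  by rewrite ler_nat sub_count // => x /= /lt_le_trans; apply.
- have lt_nkq : n%:R < k%:R + q.
    by rewrite ltNge; apply/negP => /(implyP v_target); rewrite leqNgt in_R.
  have : (count (<= u)%O X)%:R <= (count (<= v)%O X)%:R :> R.
    by rewrite ler_nat sub_count // => x /= /le_trans; apply.
  by rewrite count_gt natrB ?count_size // -/n; lra.
rewrite count_between.
have [le_uv|lt_vu] := leqP (count (<= u)%O X) (count (< v)%O X).
  by rewrite natrB //; lra.
by rewrite (eqP (ltnW lt_vu)); lra.
Qed.

Lemma round_cost_le_good : round_cost cost S <=
  n%:R + (minn k (n - k))%:R + 2 * q + 1 + 2 * B s + B (Num.truncn (4 * q + 2)).
Proof.
apply: le_trans (round_cost_le cS step7_cost_le_good) _.
by rewrite !lerD2r step4_count_le_good.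
Qed.

End GoodPivots.

Lemma mean_round_cost_le : x0 \in X -> mean_round_cost cost <=
  n%:R + (minn k (n - k))%:R + 2 * q + 1 + 2 * B s + B (Num.truncn (4 * q + 2))
  + (2 * n%:R + B n) * (4 * hoeffding_tail s g).
Proof.
move=> x0X; have le_sn : (s <= #|'I_n|)%N by rewrite card_ord; case/andP: s_bounds.
have q_ge0 : 0 <= q by exact: rank_gap_ge0.
have W_ge0 : 0 <= 2 * n%:R + B n by rewrite addr_ge0 ?mulr_ge0.
apply: le_trans (sample_mean_le_except (E := fun S => ~~ good_pivots s g x0 k S)
  (b := 2 * n%:R + B n) le_sn _ _) _.
- by move=> S cS /negPn; exact: round_cost_le_good.
- move=> S cS; apply: le_trans (round_cost_le_double x0X cS) _.
  have := B_homo (leq_pred n); have := B_ge0 (Num.truncn (4 * q + 2)).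
  by have := ler0n R n; have := ler0n R (minn k (n - k)); have := q_ge0; lra.
by rewrite lerD2l ler_wpM2l // prob_not_good_pivots_le.
Qed.

End Round.

(** * The sample size and the gap *)

Section SampleSizes.
Variable R : realType.
Implicit Types (n m : nat) (c x y : R).

Lemma ler_cube x y : 0 <= y -> x ^+ 3 <= y ^+ 3 -> x <= y.
Proof.
move=> y_ge0; have [x_lt0 _|x_ge0] := ltrP x 0; first exact: le_trans (ltW x_lt0) y_ge0.
by rewrite ler_pXn2r.
Qed.

Lemma ln_nat_ge0 n : 0 <= ln n%:R :> R.
Proof. by case: n => [|n]; [rewrite ln0 | rewrite ln_ge0 // ler1n]. Qed.

Lemma ln_nat_le m n : (m <= n)%N -> ln m%:R <= ln n%:R :> R.
Proof.
case: m => [|m] le_mn; first by rewrite ln0 // ln_nat_ge0.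
by rewrite ler_ln ?posrE ?ltr0n ?ler_nat // (leq_trans _ le_mn).
Qed.

Lemma ln_nat_near_le c : 0 < c -> \forall n \near \oo%classic, ln n%:R <= c * n%:R.
Proof.
move=> c_gt0; near=> n; set r := Num.sqrt n%:R : R.
have n_ge : (2 / c) ^+ 2 <= n%:R by near: n; exact: nbhs_infty_ger.
have n_gt0 : 0 < n%:R :> R by apply: lt_le_trans n_ge; rewrite exprn_gt0 ?divr_gt0.
have r_gt0 : 0 < r by rewrite sqrtr_gt0.
have nE : n%:R = r ^+ 2 by rewrite sqr_sqrtr // ltW.
have r_ge : 2 <= c * r.
  by rewrite mulrC -ler_pdivrMr // -(ler_pXn2r (n := 2)) ?nnegrE -?nE ?divr_ge0 // ltW.
have ln_le := ltW (ln_sublinear r_gt0).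
rewrite nE lnXn // -mulr_natl; apply: (@le_trans _ _ (2 * r)); first by rewrite ler_wpM2l.
by rewrite expr2 mulrA ler_wpM2r // ltW.
Unshelve. all: by end_near. Qed.

Lemma fsel_ge0 n : 0 <= fsel R n.
Proof. by rewrite mulr_ge0 ?powR_ge0. Qed.

Lemma fsel_gt0 n : (1 < n)%N -> 0 < fsel R n.
Proof.
move=> n_gt1; rewrite mulr_gt0 // powR_gt0 ?ltr0n 1?(ltnW n_gt1) //.
by rewrite ln_gt0 // ltr1n.
Qed.

Lemma fsel_cube n : fsel R n ^+ 3 = n%:R ^+ 2 * ln n%:R.
Proof.
rewrite /fsel exprMn -!(powR_mulrn 3) ?powR_ge0 // -!powRrM.
have -> : 2 / 3 * 3 = 2 :> R by field.
have -> : 1 / 3 * 3 = 1 :> R by field.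
by rewrite powRr1 ?ln_nat_ge0 // powR_mulrn.
Qed.

Lemma fsel_scale_le c m n : 0 <= c <= 1 -> m%:R <= c ^+ 3 * n%:R ->
  fsel R m <= c ^+ 2 * fsel R n.
Proof.
move=> /andP[c_ge0 c_le1] le_m.
apply: ler_cube; first by rewrite mulr_ge0 ?exprn_ge0 ?fsel_ge0.
have le_mn : (m <= n)%N.
  by rewrite -(ler_nat R) (le_trans le_m) // ler_piMl // exprn_ile1.
rewrite [leRHS]exprMn !fsel_cube mulrA ler_pM ?sqr_ge0 ?ln_nat_ge0 ?ln_nat_le //.
rewrite (_ : _ * _ = (c ^+ 3 * n%:R) ^+ 2); last by ring.
by rewrite lerXn2r ?nnegrE ?mulr_ge0 ?exprn_ge0.
Qed.

Lemma fsel_homo : {homo fsel R : m n / (m <= n)%N >-> m <= n}.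
Proof.
move=> m n le_mn; rewrite -[leRHS]mul1r -(expr1n R 2); apply: fsel_scale_le.
  by rewrite ler01 lexx.
by rewrite expr1n mul1r ler_nat.
Qed.

Lemma fsel_near_le c : 0 < c -> \forall n \near \oo%classic, fsel R n <= c * n%:R.
Proof.
move=> c_gt0; near=> n; apply: ler_cube; first by rewrite mulr_ge0 // ltW.
rewrite fsel_cube (_ : (c * n%:R) ^+ 3 = n%:R ^+ 2 * (c ^+ 3 * n%:R)); last by ring.
rewrite ler_wpM2l ?sqr_ge0 //; near: n.
by apply: ln_nat_near_le; rewrite exprn_gt0.
Unshelve. all: by end_near. Qed.

Section SampleSize.
Variable alpha : R.
Hypothesis alpha_gt0 : 0 < alpha.

Lemma ssel_lt n : (0 < n)%N -> (ssel alpha n < n)%N.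
Proof. by move=> n_gt0; rewrite -{2}(prednK n_gt0) ltnS geq_minr. Qed.

Lemma ssel_gt0 n : (1 < n)%N -> (0 < ssel alpha n)%N.
Proof.
move=> n_gt1; rewrite leq_min absz_gt0; apply/andP; split; last by case: n n_gt1 => [|[]].
by rewrite gt_eqF // ceil_gt0 mulr_gt0 // fsel_gt0.
Qed.

Let natr_ceilE n :
  `|Num.ceil (alpha * fsel R n)|%N%:R = (Num.ceil (alpha * fsel R n))%:~R :> R.
Proof.
rewrite natr_absz ger0_norm // ceil_ge0.
by have := mulr_ge0 (ltW alpha_gt0) (fsel_ge0 n); lra.
Qed.

Lemma ssel_le n : (ssel alpha n)%:R <= alpha * fsel R n + 1.
Proof.
apply: (@le_trans _ _ `|Num.ceil (alpha * fsel R n)|%N%:R); first by rewrite ler_nat geq_minl.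
by rewrite natr_ceilE; have := ceilB1_lt (alpha * fsel R n); rewrite intrB; lra.
Qed.

Lemma ssel_ge n : alpha * fsel R n <= n.-1%:R -> alpha * fsel R n <= (ssel alpha n)%:R.
Proof. by move=> le_pred; rewrite /ssel; case: leqP => _; rewrite // natr_ceilE ceil_ge. Qed.

Lemma ssel_near_ge : \forall n \near \oo%classic, alpha * fsel R n <= (ssel alpha n)%:R.
Proof.
have alpha2_gt0 : 0 < (2 * alpha)^-1 by rewrite invr_gt0 mulr_gt0.
near=> n; apply: ssel_ge.
have n_ge2 : 2 <= n%:R :> R by near: n; exact: nbhs_infty_ger.
have n_gt0 : (0 < n)%N by rewrite -(ltr_nat R); lra.
have : fsel R n <= (2 * alpha)^-1 * n%:R by near: n; exact: fsel_near_le.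
by rewrite ler_pdivlMl ?mulr_gt0 // -subn1 natrB //; lra.
Unshelve. all: by end_near. Qed.

Variable beta : R.

Lemma gsel_ge0 n : 0 <= gsel alpha beta n.
Proof. exact: sqrtr_ge0. Qed.

Lemma rank_gap_sel_le n : 0 <= beta -> (0 < ssel alpha n)%N ->
  alpha * fsel R n <= (ssel alpha n)%:R ->
  rank_gap (ssel alpha n) (gsel alpha beta n) n <= Num.sqrt (beta / alpha) * fsel R n.
Proof.
move=> beta_ge0 s_gt0 s_ge; have f_ge0 := fsel_ge0 n.
have ratio_ge0 : 0 <= beta / alpha by rewrite divr_ge0 // ltW.
have s_neq0 : (ssel alpha n)%:R != 0 :> R by rewrite pnatr_eq0 -lt0n.
rewrite -(ler_pXn2r (n := 2)) ?nnegrE ?rank_gap_ge0 ?gsel_ge0 ?(mulr_ge0 (sqrtr_ge0 _)) //.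
rewrite [leRHS]exprMn sqr_sqrtr //.
rewrite [leLHS](_ : _ = beta * fsel R n ^+ 3 / (ssel alpha n)%:R); last first.
  rewrite fsel_cube /rank_gap !exprMn exprVn sqr_sqrtr; first by field.
  by rewrite !mulr_ge0 ?ln_nat_ge0.
rewrite ler_pdivrMr ?ltr0n //.
rewrite (_ : beta * _ = beta / alpha * fsel R n ^+ 2 * (alpha * fsel R n)); last first.
  by field; exact: lt0r_neq0.
by rewrite ler_wpM2l // mulr_ge0 ?sqr_ge0.
Qed.

(* The tail is n^(- 2 beta) <= n^(- 1/3), whereas f(n) / n = n^(- 1/3) ln^(1/3) n. *)
Lemma hoeffding_tail_sel_le n : 1 / 6 <= beta -> (0 < ssel alpha n)%N -> 1 <= ln n%:R :> R ->
  hoeffding_tail (ssel alpha n) (gsel alpha beta n) * n%:R <= fsel R n.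
Proof.
move=> beta_ge s_gt0 ln_ge1.
have s_neq0 : (ssel alpha n)%:R != 0 :> R by rewrite pnatr_eq0 -lt0n.
have n_gt0 : 0 < n%:R :> R.
  by rewrite lt0r ler0n andbT; apply: contraTneq ln_ge1 => ->; rewrite ln0 // ler10.
have tailE : hoeffding_tail (ssel alpha n) (gsel alpha beta n) = expR (- (2 * beta * ln n%:R)).
  rewrite /hoeffding_tail sqr_sqrtr ?mulr_ge0 ?ln_nat_ge0 //; last by lra.
  by congr expR; field.
apply: ler_cube; first exact: fsel_ge0.
rewrite fsel_cube exprMn tailE -expRM_natl.
apply: (@le_trans _ _ (n%:R^-1 * n%:R ^+ 3)).
  by rewrite ler_wpM2r ?exprn_ge0 // -[n%:R in leRHS](@lnK R) ?posrE // -expRN ler_expR; nra.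
by rewrite exprS mulKf ?lt0r_neq0 // ler_peMr ?sqr_ge0.
Qed.

Lemma sampling_params_near : 1 / 6 <= beta ->
  exists2 K : R, 0 < K & \forall n \near \oo%classic,
    [/\ 1 <= fsel R n, (ssel alpha n)%:R <= K * fsel R n,
        rank_gap (ssel alpha n) (gsel alpha beta n) n <= K * fsel R n &
        hoeffding_tail (ssel alpha n) (gsel alpha beta n) * n%:R <= fsel R n].
Proof.
move=> beta_ge; pose c := Num.sqrt (beta / alpha).
have c_ge0 : 0 <= c by exact: sqrtr_ge0.
exists (alpha + 1 + c); first by have := alpha_gt0; lra.
near=> n; have f_ge0 := fsel_ge0 n.
have n_gt1 : (1 < n)%N by near: n; exact: nbhs_infty_gt.
have e_le_n : expR 1 <= n%:R :> R by near: n; exact: nbhs_infty_ger.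
have ln_ge1 : 1 <= ln n%:R :> R.
  by rewrite -[leLHS]expRK ler_ln ?posrE ?expR_gt0 // ltr0n ltnW.
have s_gt0 := ssel_gt0 n_gt1.
have s_ge : alpha * fsel R n <= (ssel alpha n)%:R by near: n; exact: ssel_near_ge.
have f_ge1 : 1 <= fsel R n.
  by apply: ler_cube => //; rewrite fsel_cube expr1n mulr_ege1 // exprn_ege1 // ler1n ltnW.
have s_le := ssel_le n; have gap_le := rank_gap_sel_le _ s_gt0 s_ge.
have cf_ge0 : 0 <= c * fsel R n by rewrite mulr_ge0.
have af_ge0 : 0 <= alpha * fsel R n by rewrite mulr_ge0 // ltW.
split=> //; last exact: hoeffding_tail_sel_le.
  by move: s_le; rewrite !mulrDl; lra.
by apply: le_trans (gap_le _) _; rewrite ?mulrDl -/c; lra.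
Unshelve. all: by end_near. Qed.

End SampleSize.

End SampleSizes.

(** * The recurrence *)

Lemma minn_sub_le_half (R : realFieldType) (j m : nat) : (minn j (m - j))%:R <= m%:R / 2 :> R.
Proof. by rewrite ler_pdivlMr // -natrM ler_nat; lia. Qed.

Definition select_bound (R : realType) (gamma : R) (n k : nat) : R :=
  n%:R + (minn k (n - k))%:R + gamma * fsel R n.

Definition uniform_bound (R : realType) (gamma : R) (n : nat) : R :=
  3 / 2 * n%:R + gamma * fsel R n.

Section Bounds.
Variables (R : realType) (gamma : R).
Hypothesis gamma_ge0 : 0 <= gamma.
Implicit Types (m n k : nat).

Lemma select_bound_ge0 n k : 0 <= select_bound gamma n k.
Proof. by rewrite addr_ge0 ?(mulr_ge0 gamma_ge0) ?fsel_ge0 // addr_ge0. Qed.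

Lemma select_bound_le_uniform n k : select_bound gamma n k <= uniform_bound gamma n.
Proof. by rewrite lerD2r; have := minn_sub_le_half R k n; lra. Qed.

Lemma uniform_bound_ge0 n : 0 <= uniform_bound gamma n.
Proof. by rewrite addr_ge0 ?(mulr_ge0 gamma_ge0) ?fsel_ge0 // mulr_ge0. Qed.

Lemma uniform_bound_homo : {homo uniform_bound gamma : m n / (m <= n)%N >-> m <= n}.
Proof. by move=> m n le_mn; rewrite lerD // ler_wpM2l ?ler_nat ?fsel_homo. Qed.

Lemma uniform_bound_small m n : m%:R <= n%:R / 64 :> R ->
  uniform_bound gamma m <= 3 / 2 * m%:R + gamma * fsel R n / 16.
Proof.
move=> le_m; rewrite lerD2l -mulrA ler_wpM2l // mulrC.
have -> : 16^-1 = (1 / 4) ^+ 2 :> R by field.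
by apply: fsel_scale_le; [apply/andP; split | ]; lra.
Qed.

End Bounds.

Lemma mean_round_cost_le_select_bound (R : realType) (s : nat) (g K gamma : R)
    (disp : Order.disp_t) (T : orderType disp) (x0 : T) (X : seq T) (k : nat)
    (cost : seq T -> nat -> R) :
  let n := size X in let f := fsel R n in
  x0 \in X -> (1 <= k <= n)%N -> (0 < s <= n)%N -> 0 <= g -> 0 <= K ->
  1 <= f -> s%:R <= K * f -> rank_gap s g n <= K * f -> hoeffding_tail s g * n%:R <= f ->
  64 * (4 * K + 2) * f <= n%:R -> 2 * (11 * K + 18) <= gamma ->
  bounded_cost cost (select_bound gamma) ->
  mean_round_cost s g x0 X k cost <= select_bound gamma n k.
Proof.
move=> n f x0X k_bounds s_bounds g_ge0 K_ge0 f_ge1 s_le q_le tail_le f_le gamma_ge costB.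
set q := rank_gap s g n in q_le.
have gamma_ge0 : 0 <= gamma by lra.
have q_ge0 : 0 <= q by exact: rank_gap_ge0.
have costB_uniform : bounded_cost cost (fun m _ => uniform_bound gamma m).
  by move=> Y j /costB/le_trans; apply; exact: select_bound_le_uniform.
have Kf_ge0 : 0 <= K * f by rewrite mulr_ge0 //; lra.
have Kf_le : 64 * (4 * (K * f) + 2 * f) <= n%:R by rewrite (le_trans _ f_le) //; lra.
have := mean_round_cost_le (uniform_bound_ge0 gamma_ge0) (uniform_bound_homo gamma_ge0)
  costB_uniform k_bounds s_bounds g_ge0 x0X.
move/le_trans; apply; rewrite -/n -/q.
set m := Num.truncn _; set t := hoeffding_tail _ _ in tail_le *.
have t_ge0 : 0 <= t by exact: expR_ge0.
have m_le : m%:R <= 4 * q + 2 by rewrite truncn_le; lra.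
have := uniform_bound_small gamma_ge0 (_ : s%:R <= n%:R / 64); rewrite -/f => bound_s.
have := uniform_bound_small gamma_ge0 (_ : m%:R <= n%:R / 64); rewrite -/f => bound_m.
have t_le : t <= 1 / 16.
  rewrite -(ler_pM2r (_ : 0 < n%:R)); last by lra.
  by apply: le_trans tail_le _; lra.
have tail_gamma_le : t * (gamma * f) <= 1 / 16 * (gamma * f).
  by rewrite ler_wpM2r // mulr_ge0 //; lra.
have gamma_f_ge : 2 * (11 * (K * f) + 18 * f) <= gamma * f.
  by rewrite (le_trans _ (ler_wpM2r _ gamma_ge)) //; lra.
have -> : (2 * n%:R + uniform_bound gamma n) * (4 * t) =
    14 * (t * n%:R) + 4 * (t * (gamma * f)).
  by rewrite /uniform_bound -/f; field.
rewrite /select_bound -/f.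
(* 8 q + 4 + 3 s + 14 t n <= (11 K + 18) f, and the terms in gamma f sum to 7/16 gamma f *)
by have := bound_s _; have := bound_m _; lra.
Qed.

Section Recurrence.
Variables (R : realType) (alpha beta : R).
Variables (disp : Order.disp_t) (T : orderType disp).
Implicit Types (X : seq T) (fuel k : nat) (cost : seq T -> nat -> R).

Lemma sel_costS fuel x0 X k : (1 < size (x0 :: X))%N ->
  sel_cost alpha beta fuel.+1 (x0 :: X) k
    = mean_round_cost (ssel alpha (size (x0 :: X))) (gsel alpha beta (size (x0 :: X)))
        x0 (x0 :: X) k (sel_cost alpha beta fuel).
Proof. by move=> n_gt1; rewrite /= ifN // gtn_eqF. Qed.

Lemma sel_cost_size_le1 fuel X k : (size X <= 1)%N -> sel_cost alpha beta fuel X k = 0.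
Proof. by case: fuel X => [|fuel] [|x0 [|x1 X]]. Qed.

Lemma bounded_sel_cost_ind (N : nat) (B : nat -> nat -> R) :
  (1 < N)%N -> (forall n k, 0 <= B n k) ->
  (forall fuel X k, (size X < N)%N -> (1 <= k <= size X)%N ->
    sel_cost alpha beta fuel X k <= B (size X) k) ->
  (forall cost x0 X k, (N <= size X)%N -> (1 <= k <= size X)%N -> x0 \in X ->
    bounded_cost cost B ->
    mean_round_cost (ssel alpha (size X)) (gsel alpha beta (size X)) x0 X k cost
      <= B (size X) k) ->
  forall fuel, bounded_cost (@sel_cost R alpha beta disp T fuel) B.
Proof.
move=> N_gt1 B_ge0 small large; elim=> [|fuel IH] X k k_bounds; first exact: B_ge0.
have [lt_nN|le_Nn] := ltnP (size X) N; first exact: small.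
have n_gt1 : (1 < size X)%N by exact: leq_trans le_Nn.
case: X => [|x0 X] // in k_bounds le_Nn n_gt1 *.
by rewrite sel_costS //; apply: large; rewrite ?mem_head.
Qed.

Hypothesis alpha_gt0 : 0 < alpha.

Lemma bounded_sel_cost_exp fuel :
  bounded_cost (@sel_cost R alpha beta disp T fuel) (fun n _ => 2 * 4 ^+ n).
Proof.
pose B n : R := 2 * 4 ^+ n.
have B_ge0 n : 0 <= B n by rewrite mulr_ge0 ?exprn_ge0.
have B_homo : {homo B : m p / (m <= p)%N >-> m <= p}.
  by move=> m p le_mp; rewrite ler_pM2l // ler_weXn2l // ler1n.
apply: (@bounded_sel_cost_ind 2) => // [{}fuel X k lt2|cost x0 X k n_gt1 k_bounds x0X costB].
  by rewrite sel_cost_size_le1 //; exact: B_ge0.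
have n_gt0 : (0 < size X)%N by exact: ltnW.
have s_bounds : (0 < ssel alpha (size X) <= size X)%N by rewrite ssel_gt0 //= ltnW // ssel_lt.
have le_sn : (ssel alpha (size X) <= #|'I_(size X)|)%N.
  by rewrite card_ord; case/andP: s_bounds.
rewrite -[leRHS](sample_mean_cst _ le_sn); apply: sample_mean_le => S cS.
apply: le_trans (round_cost_le_double B_ge0 B_homo costB k_bounds s_bounds _ x0X cS) _.
  exact: gsel_ge0.
have B_s : B (ssel alpha (size X)) <= B (size X).-1.
  by apply: B_homo; rewrite -ltnS prednK // ssel_lt.
have n_le : (size X)%:R <= 4 ^+ (size X).-1 :> R.
  by rewrite -natrX ler_nat -{1}(prednK n_gt0) ltn_expl.
have exp_n : 4 ^+ size X = 4 * 4 ^+ (size X).-1 :> R by rewrite -exprS prednK.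
by move: B_s n_le; rewrite /B {}exp_n; do 2!move: (4 ^+ _) => ?; lra.
Qed.

Lemma sel_cost_le_fsel N fuel X k : (size X < N)%N -> (1 <= k <= size X)%N ->
  sel_cost alpha beta fuel X k <= 2 * 4 ^+ N / fsel R 2 * fsel R (size X).
Proof.
move=> lt_nN k_bounds; have f2_gt0 : 0 < fsel R 2 by exact: fsel_gt0.
have C_ge0 : 0 <= 2 * 4 ^+ N / fsel R 2 by rewrite divr_ge0 ?fsel_ge0 // mulr_ge0 ?exprn_ge0.
have [n_le1|n_gt1] := leqP (size X) 1.
  by rewrite sel_cost_size_le1 // (mulr_ge0 C_ge0) ?fsel_ge0.
apply: le_trans (bounded_sel_cost_exp fuel k_bounds) _.
apply: le_trans (ler_wpM2l C_ge0 (fsel_homo R n_gt1)).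
by rewrite divfK ?lt0r_neq0 // ler_pM2l // ler_weXn2l ?ler1n // ltnW.
Qed.

End Recurrence.

Lemma mean_round_cost_sel_le (R : realType) (alpha beta : R) :
  0 < alpha -> 1 / 6 <= beta ->
  exists (G : R) (N : nat), [/\ 0 < G, (1 < N)%N &
    forall (gamma : R) (disp : Order.disp_t) (T : orderType disp) cost (x0 : T) (X : seq T) k,
      G <= gamma -> (N <= size X)%N -> (1 <= k <= size X)%N -> x0 \in X ->
      bounded_cost cost (select_bound gamma) ->
      mean_round_cost (ssel alpha (size X)) (gsel alpha beta (size X)) x0 X k cost
        <= select_bound gamma (size X) k].
Proof.
move=> alpha_gt0 beta_ge; have [K K_gt0 params] := sampling_params_near alpha_gt0 beta_ge.
have D_gt0 : 0 < 64 * (4 * K + 2) by lra.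
have f_small : \forall n \near \oo%classic, fsel R n <= (64 * (4 * K + 2))^-1 * n%:R.
  by apply: fsel_near_le; rewrite invr_gt0.
have [N _ large] := filterI params f_small.
exists (2 * (11 * K + 18)), (maxn N 2); split; [lra | by rewrite leq_maxr |].
move=> gamma disp T cost x0 X k gamma_ge; rewrite geq_max => /andP[le_N n_gt1].
move=> k_bounds x0X costB.
have [[f_ge1 s_le gap_le tail_le] f_le] := large _ le_N.
apply: (mean_round_cost_le_select_bound x0X k_bounds _ (gsel_ge0 _ _ _) (ltW K_gt0)
  f_ge1 s_le gap_le tail_le _ gamma_ge costB).
- by rewrite ssel_gt0 //= ltnW // ssel_lt // ltnW.
- by rewrite -ler_pdivlMl.
Qed.

Theorem theorem4p1 (R : realType) (alpha beta : R) :
  0 < alpha -> 1 / 6 <= beta ->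
  exists gamma : R, 0 < gamma /\
    forall (d : Order.disp_t) (T : orderType d) (n k : nat) (X : seq T),
      (1 <= n)%N -> (1 <= k <= n)%N -> size X = n ->
      select_cost alpha beta X k
        <= n%:R + (minn k (n - k))%:R + gamma * fsel R n.
Proof.
move=> alpha_gt0 beta_ge.
have [G [N [G_gt0 N_gt1 large]]] := mean_round_cost_sel_le alpha_gt0 beta_ge.
pose C : R := 2 * 4 ^+ N / fsel R 2.
have C_ge0 : 0 <= C by rewrite divr_ge0 ?fsel_ge0 // mulr_ge0 ?exprn_ge0.
exists (G + C); split=> [|d T n k X _ k_bounds sX]; first by lra.
rewrite -sX in k_bounds *.
apply: (bounded_sel_cost_ind (B := select_bound (G + C)) N_gt1) => //.
- by move=> m j; apply: select_bound_ge0; lra.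
- move=> fuel Y j lt_N j_bounds.
  apply: le_trans (sel_cost_le_fsel _ alpha_gt0 _ lt_N j_bounds) _.
  by rewrite ler_wpDl ?addr_ge0 // ler_wpM2r ?fsel_ge0 // -/C; lra.
- by move=> cost x0 Y j; apply: large; lra.
Qed.
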